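(* Let $n\ge3$, let $P$ be a positive-area local optimum, let $\theta=(\lambda,\ell,r,d,u)$ be a normalized KKT multiplier at $P$, and let $\mathcal H$ be a nonempty family of triangles $t$ with $\lambda_t>0$, whose set of vertices is partitioned as $V(\mathcal H)=I\sqcup\{a,b\}$ with $a\ne b$. Put $B_{\mathcal H}=\sum_{t\in\mathcal H}\lambda_tB_t$ and define $b^{\mathcal H}_i\in\mathbb R^2\cong\mathbb C$ by $B_{\mathcal H}z=2\mathrm i\,b^{\mathcal H}$, $z=(x_i+\mathrm i y_i)_i$. Let $\xi\in K_{\mathrm{sh}}(P)$ satisfy $(B_{\mathcal H}\xi)_i=0$ for all $i\in I$. Then there is a scalar $\rho\in\mathbb R$ such that $$B_{\mathcal H}\xi=\rho(e_a-e_b).$$ Writing $p_i=(X_i,Y_i)$ and $\Omega(x,y)=(-y,x)$, one has $$\sum_i\xi_i(b_i^{\mathcal H})^T=\frac{\rho}{2}(Y_b-Y_a,\;X_a-X_b)=\frac{\rho}{2}\,\Omega(p_a-p_b)^T$$ (as row vectors), and $$\rho(\xi_a-\xi_b)=0 .$$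
   Context: A configuration is $P=(p_1,\dots,p_n)$ with $p_i=(x_i,y_i)\in[0,1]^2$ (coordinates also written $X_i=x_i,Y_i=y_i$). For a triple $t=(i,j,k)$, $i<j<k$, put $D_t(P)=\det(p_j-p_i,p_k-p_i)$, $A_t(P)=\tfrac12|D_t(P)|$, and $\delta(P)=\min_tA_t(P)$. A positive-area local optimum is a local maximizer $P$ of $\delta$ on $([0,1]^2)^n$ with $\Delta:=\delta(P)>0$. Put $s_t=\operatorname{sgn}D_t(P)$; near $P$, $A_t=\tfrac12s_tD_t$, which is used for derivatives. A normalized KKT multiplier at $P$ is a tuple $q=(\lambda,\ell,r,d,u)$ of nonnegative reals $\lambda_t$ (all triples $t$), $\ell_i,r_i,d_i,u_i$ ($i\in[n]$) with: $\lambda_t=0$ unless $A_t(P)=\Delta$; $\ell_i=0$ unless $x_i=0$, $r_i=0$ unless $x_i=1$, $d_i=0$ unless $y_i=0$, $u_i=0$ unless $y_i=1$; $\sum_t\lambda_t=1$; and $\sum_t\lambda_t\nabla_{p_i}A_t(P)+(\ell_i-r_i,d_i-u_i)=0$ for all $i$. Their set is $\mathcal K(P)$. For $t=(i,j,k)$, $i<j<k$, let $B_t=s_t(a_tc_t^T-c_ta_t^T)\in\mathbb R^{n\times n}$, $a_t=e_j-e_i$, $c_t=e_k-e_i$ ($e_i$ the standard basis), and $B(q)=\sum_t\lambda_tB_t$. The shared kernel is $K_{\mathrm{sh}}(P)=\bigcap_{q\in\mathcal K(P)}\ker B(q)\subset\mathbb R^n$. *)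

(* Defs.v *)
From HB Require Import structures.
From mathcomp Require Import all_boot all_order all_algebra.
From mathcomp Require Import all_classical all_reals all_analysis.
From mathcomp.real_closed Require Import complex.

Set Implicit Arguments.
Unset Strict Implicit.
Unset Printing Implicit Defensive.

Import Order.TTheory GRing.Theory Num.Theory.
Import numFieldNormedType.Exports.

Local Open Scope classical_set_scope.
Local Open Scope ring_scope.
Local Open Scope complex_scope.

Section Heilbronn.
Variables (R : realType) (n : nat).

(* A configuration is a 2 x n matrix whose i-th column is p_i = (x_i, y_i). *)
Definition config := 'M[R]_(2, n).

Definition px (P : config) (i : 'I_n) : R := P 0 i.
Definition py (P : config) (i : 'I_n) : R := P 1 i.

Definition in_square (P : config) : Prop :=
  forall c i, 0 <= P c i <= 1.

Definition triple : finType :=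
  {t : 'I_n * 'I_n * 'I_n | (t.1.1 < t.1.2)%N && (t.1.2 < t.2)%N}.

Definition ti (t : triple) : 'I_n := (val t).1.1.
Definition tj (t : triple) : 'I_n := (val t).1.2.
Definition tk (t : triple) : 'I_n := (val t).2.

Definition Dt (t : triple) (P : config) : R :=
  \det (row_mx (col (tj t) P - col (ti t) P) (col (tk t) P - col (ti t) P)
        : 'M[R]_2).

Definition area (t : triple) (P : config) : R := `|Dt t P| / 2.

(* A minimum for n >= 3, see min_area_le and min_area_attained; it is 0 by
   convention when there is no triple. *)
Definition min_area (P : config) : R := inf (range (fun t => area t P)).

(* Neighbourhoods are those of the sup-norm topology on 2 x n matrices. *)
Definition local_optimum (P : config) : Prop :=
  in_square P /\
  \forall Q \near P, in_square Q -> min_area Q <= min_area P.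

Definition positive_area_local_optimum (P : config) : Prop :=
  local_optimum P /\ 0 < min_area P.

Definition vec2 (x y : R) : 'cV[R]_2 := \col_c (if c == 0 then x else y).

(* delta_mx c i is the direction that moves coordinate c of p_i alone. *)
Definition grad_area (t : triple) (P : config) (i : 'I_n) : 'cV[R]_2 :=
  \col_c 'D_(delta_mx c i) (area t) P.

Record multiplier := Multiplier {
  lam : triple -> R;
  left_mult : 'I_n -> R;
  right_mult : 'I_n -> R;
  down_mult : 'I_n -> R;
  up_mult : 'I_n -> R
}.

Record normalized_KKT (P : config) (q : multiplier) : Prop := NormalizedKKT {
  lam_ge0 : forall t, 0 <= lam q t;
  left_ge0 : forall i, 0 <= left_mult q i;
  right_ge0 : forall i, 0 <= right_mult q i;
  down_ge0 : forall i, 0 <= down_mult q i;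
  up_ge0 : forall i, 0 <= up_mult q i;
  lam_active : forall t, area t P <> min_area P -> lam q t = 0;
  left_active : forall i, px P i <> 0 -> left_mult q i = 0;
  right_active : forall i, px P i <> 1 -> right_mult q i = 0;
  down_active : forall i, py P i <> 0 -> down_mult q i = 0;
  up_active : forall i, py P i <> 1 -> up_mult q i = 0;
  lam_sum1 : \sum_t lam q t = 1;
  stationarity : forall i,
    \sum_t lam q t *: grad_area t P i
    + vec2 (left_mult q i - right_mult q i) (down_mult q i - up_mult q i) = 0
}.

Definition KKT_set (P : config) : set multiplier :=
  [set q | normalized_KKT P q].

Definition stdvec (i : 'I_n) : 'cV[R]_n := delta_mx i 0.

Definition Bt (P : config) (t : triple) : 'M[R]_n :=
  let a := stdvec (tj t) - stdvec (ti t) in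
  let c := stdvec (tk t) - stdvec (ti t) in
  Num.sg (Dt t P) *: (a *m c^T - c *m a^T).

Definition Bmx (P : config) (q : multiplier) : 'M[R]_n :=
  \sum_t lam q t *: Bt P t.

Definition shared_kernel (P : config) : set 'cV[R]_n :=
  \bigcap_(q in KKT_set P) [set xi | Bmx P q *m xi = 0].

Definition BH (P : config) (q : multiplier) (H : {set triple}) : 'M[R]_n :=
  \sum_(t in H) lam q t *: Bt P t.

Definition triangle_vertices (t : triple) : {set 'I_n} :=
  [set ti t; tj t; tk t]%SET.

Definition vertices (H : {set triple}) : {set 'I_n} :=
  (\bigcup_(t in H) triangle_vertices t)%SET.

(* The identification of n points of the plane with a vector of C^n. *)
Definition cplx (Q : 'M[R]_(2, n)) : 'cV[R[i]]_n :=
  \col_i (Q 0 i +i* Q 1 i).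

Definition Omega (v : 'cV[R]_2) : 'cV[R]_2 := vec2 (- v 1 0) (v 0 0).

Lemma min_area_le (P : config) (t : triple) : min_area P <= area t P.
Proof.
apply: ge_inf; last by exists t.
by exists 0 => _ [u _ <-]; rewrite /area divr_ge0.
Qed.

Lemma min_area_attained (P : config) :
  (3 <= n)%N -> exists t : triple, min_area P = area t P.
Proof.
move=> n3.
have n0 : (0 < n)%N by apply: leq_trans n3.
have n1 : (1 < n)%N by apply: leq_trans n3.
pose t0 : triple :=
  exist _ (Ordinal n0, Ordinal n1, Ordinal n3) (erefl true).
have [t _ tmin] := @Order.TotalTheory.arg_minP _ _ _ t0 predT
  (fun t => area t P) erefl.
exists t; apply/eqP; rewrite eq_le min_area_le /=.
apply: lb_le_inf; first by exists (area t P), t.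
by move=> _ [u _ <-]; exact: tmin.
Qed.

End Heilbronn.

(* Main.v *)
(* Every B_t is skew-symmetric with zero column sums, and its rows outside the
   vertices of t vanish; B = B_H inherits all of this.  So B xi is supported on
   {a, b} with zero sum, hence B xi = rho (e_a - e_b).  Skew-symmetry then gives
   rho (xi_a - xi_b) = xi^T B xi = 0 and
   2i (sum_i xi_i b_i) = xi^T B z = - (B xi)^T z = - rho (z_a - z_b). *)
Require Import Defs.
From HB Require Import structures.
From mathcomp Require Import all_boot all_order all_algebra.
From mathcomp Require Import all_classical all_reals all_analysis.
From mathcomp.real_closed Require Import complex.
From mathcomp Require Import lra.
Import Order.TTheory GRing.Theory Num.Theory.
Local Open Scope ring_scope.
Local Open Scope complex_scope.

Section TriangleMatrices.
Variables (R : realType) (n : nat) (P : config R n).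

Lemma trmx_Bt (t : triple n) : (Bt P t)^T = - Bt P t.
Proof. by rewrite /Bt linearZ /= linearB /= !trmx_mul !trmxK -scalerN opprB. Qed.

Lemma trmx_BH (q : multiplier R n) (H : {set triple n}) :
  (BH P q H)^T = - BH P q H.
Proof.
rewrite /BH linear_sum /= -sumrN; apply: eq_bigr => t _.
by rewrite linearZ /= trmx_Bt scalerN.
Qed.

(** The all-ones row vector annihilates every edge vector [e_j - e_i], hence both rank-one terms
    [a c^T] and [c a^T] of [Bt]. *)
Lemma sum_Bt_mul (t : triple n) (v : 'cV[R]_n) : \sum_i (Bt P t *m v) i 0 = 0.
Proof.
have sum_mul1 (w : 'cV[R]_n) : \sum_i w i 0 = ((const_mx 1 : 'rV_n) *m w) 0 0.
  by rewrite mxE; apply: eq_bigr => i _; rewrite mxE mul1r.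
have edge0 (i j : 'I_n) :
    (const_mx 1 : 'rV[R]_n) *m (stdvec R j - stdvec R i) = 0.
  rewrite mulmxBr /stdvec; apply/matrixP => k l.
  by rewrite -!colE !mxE subrr.
rewrite sum_mul1 /Bt -scalemxAl -scalemxAr mulmxA mulmxBr !mulmxA !edge0.
by rewrite !mul0mx subrr mul0mx scaler0 mxE.
Qed.

Lemma sum_BH_mul (q : multiplier R n) (H : {set triple n}) (v : 'cV[R]_n) :
  \sum_i (BH P q H *m v) i 0 = 0.
Proof.
rewrite /BH mulmx_suml; under eq_bigr do rewrite summxE.
rewrite exchange_big big1 //= => t _.
under eq_bigr do rewrite -scalemxAl mxE.
by rewrite -mulr_sumr sum_Bt_mul mulr0.
Qed.

(** Row [i] of [a c^T - c a^T] is [a_i c^T - c_i a^T], and [a], [c] are supported on the vertices of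
    [t]. *)
Lemma Bt_mul_out (t : triple n) (v : 'cV[R]_n) (i : 'I_n) :
  i \notin triangle_vertices t -> (Bt P t *m v) i 0 = 0.
Proof.
rewrite /triangle_vertices !inE !negb_or -andbA => /and3P[it jt kt].
rewrite /Bt -scalemxAl mulmxBl -!mulmxA mxE [X in _ * X]mxE [X in _ + X]mxE.
rewrite !mxE !big_ord1 !mxE.
by rewrite (negbTE it) (negbTE jt) (negbTE kt) !subrr !mul0r subrr mulr0.
Qed.

Lemma BH_mul_out (q : multiplier R n) (H : {set triple n}) (v : 'cV[R]_n)
    (i : 'I_n) :
  i \notin vertices H -> (BH P q H *m v) i 0 = 0.
Proof.
move=> iH; rewrite /BH mulmx_suml summxE big1 // => t tH.
rewrite -scalemxAl mxE Bt_mul_out ?mulr0 //.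
by apply: contra iH => it; apply/finset.bigcupP; exists t.
Qed.

End TriangleMatrices.

(** A 1 x 1 matrix is its own transpose, while skew-symmetry makes this transpose its negative;
    doubling is injective in [R]. *)
Lemma skew_quad_form0 (R : realType) (n : nat) (B : 'M[R]_n) (v : 'cV[R]_n) :
  B^T = - B -> v^T *m (B *m v) = 0.
Proof.
move=> Bskew.
have : (v^T *m (B *m v))^T = - (v^T *m (B *m v)).
  by rewrite !trmx_mul trmxK Bskew -mulmxA mulNmx mulmxN.
move/matrixP => h; apply/matrixP => i j; rewrite (ord1 i) (ord1 j).
have := h 0 0; rewrite [LHS]mxE [RHS]mxE => /eqP.
by rewrite -addr_eq0 -mulr2n mulrn_eq0 /= => /eqP ->; rewrite [RHS]mxE.
Qed.

(** Only the entries at [a] and [b] survive in the sum, so they are opposite; this provides the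
    scalar [rho] as the entry at [a]. *)
Lemma stdvec_diff_of_sum0 (R : realType) (n : nat) (a b : 'I_n) (v : 'cV[R]_n) :
  a <> b -> (forall i, i != a -> i != b -> v i 0 = 0) -> \sum_i v i 0 = 0 ->
  v = v a 0 *: (stdvec R a - stdvec R b).
Proof.
move=> /eqP ab v0.
rewrite (bigD1 a) //= (bigD1 b) 1?eq_sym //= big1 => [|i /andP[ia ib]]; last exact: v0.
rewrite addr0 => /eqP; rewrite addr_eq0 => /eqP vab.
apply/matrixP => i j; rewrite (ord1 j) !mxE eqxx !andbT.
have [->|ia] := eqVneq i a; first by rewrite (negbTE ab) subr0 mulr1.
have [->|ib] := eqVneq i b; first by rewrite sub0r mulrN1 vab opprK.
by rewrite v0 // subrr mulr0.
Qed.

(* As [2i (u + iv) = -2v + 2iu], the two coordinates get exchanged. *)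
Lemma cplx_mul_2i (R : realType) (n : nat) (B : 'M[R]_n) (Q b : 'M[R]_(2, n)) :
  map_mx (real_complex R) B *m cplx Q = (2 * 'i%C) *: cplx b ->
  B *m (row 0 Q)^T = - 2 *: (row 1 b)^T /\ B *m (row 1 Q)^T = 2 *: (row 0 b)^T.
Proof.
move=> /matrixP h; split; apply/matrixP => i j; rewrite (ord1 j).
- have /(congr1 (@complex.Re R)) := h i 0.
  rewrite !mxE raddf_sum /= => h0.
  (* The entries of [B] are real, so taking real parts commutes with multiplying by them. *)
  transitivity (\sum_k complex.Re (map_mx (real_complex R) B i k * cplx Q k 0)).
    by apply: eq_bigr => k _; rewrite !mxE /= mul0r subr0.
  by rewrite h0 /=; lra.
- have /(congr1 (@complex.Im R)) := h i 0.
  rewrite !mxE raddf_sum /= => h0.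
  transitivity (\sum_k complex.Im (map_mx (real_complex R) B i k * cplx Q k 0)).
    by apply: eq_bigr => k _; rewrite !mxE /= mul0r addr0.
  by rewrite h0 /=; lra.
Qed.

Theorem theorem7p1 (R : realType) (n : nat) (hn : (3 <= n)%N)
    (P : config R n) (hP : positive_area_local_optimum P)
    (theta : multiplier R n) (htheta : normalized_KKT P theta)
    (H : {set triple n}) (hH0 : H <> finset.set0)
    (hHpos : forall t : triple n, t \in H -> 0 < lam theta t)
    (I : {set 'I_n}) (a b : 'I_n) (hab : a <> b)
    (hV : vertices H = (I :|: [set a; b])%SET)
    (hI : [disjoint I & [set a; b]%SET])
    (bH : 'M[R]_(2, n))
    (hbH : map_mx (real_complex R) (BH P theta H) *m cplx P
           = (2 * 'i%C) *: cplx bH)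
    (xi : 'cV[R]_n) (hxi : shared_kernel P xi)
    (hxiI : forall i : 'I_n, i \in I -> (BH P theta H *m xi) i 0 = 0) :
  exists rho : R,
    [/\ BH P theta H *m xi = rho *: (stdvec R a - stdvec R b),
        \sum_i xi i 0 *: (col i bH)^T
          = (rho / 2) *: (vec2 (py P b - py P a) (px P a - px P b))^T,
        (rho / 2) *: (vec2 (py P b - py P a) (px P a - px P b))^T
          = (rho / 2) *: (Omega (col a P - col b P))^T
      & rho * (xi a 0 - xi b 0) = 0].
Proof.
set B := BH P theta H in hbH hxiI *.
have Bskew : B^T = - B by exact: trmx_BH.
have defBxi : B *m xi = (B *m xi) a 0 *: (stdvec R a - stdvec R b).
  apply: stdvec_diff_of_sum0 => // [i ia ib|]; last exact: sum_BH_mul.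
  (* An index other than [a], [b] lies either in [I], where the entry vanishes by hypothesis, or
     outside [vertices H], where the whole row of [B] is zero. *)
  have [/hxiI //|iI] := boolP (i \in I).
  by apply: BH_mul_out; rewrite hV !inE (negbTE iI) (negbTE ia) (negbTE ib).
move: ((B *m xi) a 0) defBxi => rho defBxi.
(* Used with [v = xi] for the last claim, and with the coordinate rows of [P] through [pair]. *)
have dot (v : 'cV[R]_n) : (v^T *m (B *m xi)) 0 0 = rho * (v a 0 - v b 0).
  by rewrite defBxi -scalemxAr mulmxBr /stdvec -!colE !mxE.
(* Moving [B] from [v] onto [xi] costs a sign: [xi^T B v = - v^T B xi]. *)
have pair (v w : 'cV[R]_n) : B *m v = w ->
    \sum_i xi i 0 * w i 0 = - (rho * (v a 0 - v b 0)).
  move=> <-; rewrite -dot; transitivity ((xi^T *m (B *m v))^T 0 0).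
    by rewrite mxE mxE; apply: eq_bigr => i _; rewrite [in RHS]mxE.
  by rewrite !trmx_mul trmxK Bskew mulmxN mulNmx mulmxA mxE.
have [Bx By] := cplx_mul_2i _ _ _ _ _ hbH.
exists rho; split=> //.
- apply/matrixP => i c; rewrite (ord1 i) summxE.
  under eq_bigr do rewrite !mxE.
  (* The x-coordinates of [P] determine the second component of the sum and the y-coordinates the
     first, with factors -2 and 2. *)
  have sum_x := pair _ _ Bx; have sum_y := pair _ _ By.
  rewrite (eq_bigr (fun k => - 2 * (xi k 0 * bH 1 k))) in sum_x; last first.
    by move=> k _; rewrite !mxE mulrCA.
  rewrite (eq_bigr (fun k => 2 * (xi k 0 * bH 0 k))) in sum_y; last first.
    by move=> k _; rewrite !mxE mulrCA.
  rewrite -mulr_sumr !mxE in sum_x; rewrite -mulr_sumr !mxE in sum_y.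
  (* Component 0 follows from [sum_y]; component 1, which appears as [lift 0 0], follows from
     [sum_x]. *)
  rewrite !mxE /px /py; case: (unliftP 0 c) => [k ->|->] /=; last by lra.
  by rewrite (ord1 k) (_ : lift 0 0 = 1) /=; [lra | exact/val_inj].
- by congr (_ *: _^T); apply/matrixP => c j; rewrite !mxE; case: eqP => _; rewrite ?opprB.
- by rewrite -dot skew_quad_form0 // mxE.
Qed.
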